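(* Let $k\geq 3$ and $n\geq 1$, and let $\mathsf{A}\in\mathbb{R}^{n\times n\times\cdots\times n}$ be a $k$th order supersymmetric tensor that is orthogonally decomposable, with orthogonal decomposition $\mathsf{A}=\sum_{r=1}^n\lambda_r\,\mathbf{v}_r\circ\mathbf{v}_r\circ\cdots\circ\mathbf{v}_r$ ($k$ factors in each term). Let the initial condition be $\mathbf{x}_0=\sum_{r=1}^n c_r\mathbf{v}_r$ with $c_r\in\mathbb{R}$. For the multilinear dynamical system $\mathbf{x}_{t+1}=\mathsf{A}\mathbf{x}_t^{k-1}$ started at $\mathbf{x}_0$, the equilibrium point $\mathbf{x}=\mathbf{0}$ is: (1) stable if and only if $|c_r\lambda_r^{\frac{1}{k-2}}|\leq 1$ for all $r=1,2,\dots,n$; (2) asymptotically stable if and only if $|c_r\lambda_r^{\frac{1}{k-2}}|<1$ for all $r=1,2,\dots,n$; (3) unstable if and only if $|c_r\lambda_r^{\frac{1}{k-2}}|>1$ for some $r\in\{1,2,\dots,n\}$.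
   Context: A $k$th order tensor $\mathsf{A}\in\mathbb{R}^{n\times\cdots\times n}$ ($k$ modes, each of size $n$) is supersymmetric if its entries $\mathsf{A}_{j_1j_2\dots j_k}$ are invariant under any permutation of the indices. The symbol $\circ$ denotes the vector outer product. A supersymmetric tensor is orthogonally decomposable (odeco) if it can be written as $\mathsf{A}=\sum_{r=1}^n\lambda_r\,\mathbf{v}_r\circ\cdots\circ\mathbf{v}_r$ ($k$ factors) with $\lambda_r\in\mathbb{R}$ in descending order and $\mathbf{v}_1,\dots,\mathbf{v}_n\in\mathbb{R}^n$ orthonormal; such an expression is called an orthogonal decomposition. The vector $\mathsf{A}\mathbf{x}^{k-1}\in\mathbb{R}^n$ is given by $(\mathsf{A}\mathbf{x}^{k-1})_{j}=\sum_{j_1,\dots,j_{k-1}=1}^n\mathsf{A}_{j_1\dots j_{k-1}j}\,\mathbf{x}_{j_1}\cdots\mathbf{x}_{j_{k-1}}$. Time $t=0,1,2,\dots$ is discrete. Stability notions are relative to the given initial condition $\mathbf{x}_0$, i.e. they concern the trajectory $(\mathbf{x}_t)_{t\ge 0}$ starting at $\mathbf{x}_0$. The equilibrium $\mathbf{x}=\mathbf{0}$ is stable (for $\mathbf{x}_0$) if there is $\gamma>0$ such that $\|\mathbf{x}_t\|\leq\gamma\|\mathbf{x}_0\|$ for all $t$; asymptotically stable (for $\mathbf{x}_0$) if $\mathbf{x}_t\to\mathbf{0}$ as $t\to\infty$; unstable (for $\mathbf{x}_0$) if it is not stable. Here $\|\cdot\|$ is the Euclidean norm. The quantity $|c_r\lambda_r^{1/(k-2)}|$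 means $|c_r|\,|\lambda_r|^{1/(k-2)}$. *)

(* Defs.v *)
From HB Require Import structures.
From mathcomp Require Import all_boot all_order all_algebra all_fingroup.
From mathcomp Require Import all_classical all_reals all_analysis.

Set Implicit Arguments.
Unset Strict Implicit.
Unset Printing Implicit Defensive.

Import Order.TTheory GRing.Theory Num.Theory.
Import numFieldNormedType.Exports.

Local Open Scope classical_set_scope.
Local Open Scope ring_scope.

(* [R^o] gives tensors their pointwise R-module structure. *)
Definition tensor (R : realType) (k n : nat) : Type :=
  {ffun k.-tuple 'I_n -> R^o}.

Definition supersymmetric (R : realType) (k n : nat) (A : tensor R k n) : Prop :=
  forall (s : 'S_k) (j : k.-tuple 'I_n),
    A [tuple tnth j (s i) | i < k] = A j.

Definition outer (R : realType) (k n : nat) (u : 'I_k -> 'cV[R]_n) :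
    {ffun k.-tuple 'I_n -> R^o} :=
  [ffun j : k.-tuple 'I_n => \prod_(i < k) u i (tnth j i) 0].

Definition dotv (R : realType) (n : nat) (u v : 'cV[R]_n) : R :=
  \sum_(i < n) u i 0 * v i 0.

(* The norm [`|x|] of the library on matrices is the sup norm, hence the
   separate Euclidean norm. *)
Definition enorm (R : realType) (n : nat) (x : 'cV[R]_n) : R :=
  Num.sqrt (\sum_(i < n) x i 0 ^+ 2).

Definition orthonormal_family (R : realType) (n : nat)
    (v : 'I_n -> 'cV[R]_n) : Prop :=
  forall r s : 'I_n, dotv (v r) (v s) = (r == s)%:R.

Definition orthogonal_decomposition (R : realType) (k n : nat)
    (A : tensor R k n) (lam : 'I_n -> R) (v : 'I_n -> 'cV[R]_n) : Prop :=
  [/\ forall r s : 'I_n, (r <= s)%N -> lam s <= lam r,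
      orthonormal_family v
    & A = \sum_(r < n) lam r *: outer (fun _ : 'I_k => v r)].

(* For [k >= 1], the multi-index (j_1, ..., j_(k-1), j): [i = k - 1] is out of
   bounds for [J], so [nth] returns its default value [j] there. *)
Definition idx_rcons (k n : nat) (J : k.-1.-tuple 'I_n) (j : 'I_n) :
    k.-tuple 'I_n :=
  [tuple nth j J i | i < k].

(* A x^(k-1) *)
Definition tensor_apply (R : realType) (k n : nat) (A : tensor R k n)
    (x : 'cV[R]_n) : 'cV[R]_n :=
  \col_(j < n) \sum_(J : k.-1.-tuple 'I_n)
    A (idx_rcons J j) * \prod_(i < k.-1) x (tnth J i) 0.

(* Stability of the equilibrium 0 relative to a given initial condition, i.e.
   along the single trajectory [x] starting at [x 0]. *)
Definition stable_origin (R : realType) (n : nat) (x : nat -> 'cV[R]_n) : Prop :=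
  exists2 gamma : R, 0 < gamma &
    forall t : nat, enorm (x t) <= gamma * enorm (x 0%N).

Definition asymptotically_stable_origin (R : realType) (n : nat)
    (x : nat -> 'cV[R]_n) : Prop :=
  x t @[t --> \oo] --> (0 : 'cV[R]_n).

Definition unstable_origin (R : realType) (n : nat)
    (x : nat -> 'cV[R]_n) : Prop :=
  ~ stable_origin x.

(* Main.v *)
(* In the orthonormal frame the system decouples: the coordinate a_r of x_t
   along v_r obeys a_r(t+1) = lam_r * a_r(t)^(k-1).  With
   mu_r = |lam_r|^(1/(k-2)), the rescaled modulus b = |a_r| mu_r satisfies
   b(t+1) = b(t)^(k-1), so b(t) = b(0)^((k-1)^t), whose behaviour depends only
   on the position of b(0) = |c_r| mu_r relative to 1. *)

Require Import Defs.
From HB Require Import structures.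
From mathcomp Require Import all_boot all_order all_algebra all_fingroup.
From mathcomp Require Import all_classical all_reals all_analysis.

Set Implicit Arguments.
Unset Strict Implicit.
Unset Printing Implicit Defensive.

Import Order.TTheory GRing.Theory Num.Theory.
Import numFieldNormedType.Exports.

Local Open Scope classical_set_scope.
Local Open Scope ring_scope.

Section Orthonormal.
Variables (R : realType) (n : nat).
Implicit Types (v : 'I_n -> 'cV[R]_n) (a : 'I_n -> R).

Lemma dotv_suml a v w :
  dotv (\sum_(r < n) a r *: v r) w = \sum_(r < n) a r * dotv (v r) w.
Proof.
under [RHS]eq_bigr do rewrite mulr_sumr.
rewrite exchange_big /=; apply: eq_bigr => i _.
by rewrite summxE mulr_suml; apply: eq_bigr => r _; rewrite mxE mulrA.
Qed.

Lemma dotvC (u w : 'cV[R]_n) : dotv u w = dotv w u.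
Proof. by apply: eq_bigr => i _; rewrite mulrC. Qed.

Lemma dotv_orthonormal a v s : orthonormal_family v ->
  dotv (\sum_(r < n) a r *: v r) (v s) = a s.
Proof.
move=> v_on; rewrite dotv_suml (bigD1 s) //= v_on eqxx mulr1 big1 ?addr0 //.
by move=> r /negPf rs; rewrite v_on rs mulr0.
Qed.

(** Parseval: in the pairing of the vector with itself only one factor is expanded; the other then
    yields its coordinates. *)
Lemma enorm_orthonormal a v : orthonormal_family v ->
  enorm (\sum_(r < n) a r *: v r) = Num.sqrt (\sum_(r < n) a r ^+ 2).
Proof.
move=> v_on; set x := \sum_(r < n) _; congr Num.sqrt.
transitivity (dotv x x); first by apply: eq_bigr => i _; rewrite expr2.
rewrite {1}/x dotv_suml; apply: eq_bigr => r _.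
by rewrite dotvC dotv_orthonormal.
Qed.

End Orthonormal.

(** On a rank-one term the sum over multi-indices factors into k - 1 equal sums, each the inner
    product of [x] with [v r]. *)
Lemma tensor_apply_outer (R : realType) (k n : nat) (A : tensor R k n)
    (lam : 'I_n -> R) (v : 'I_n -> 'cV[R]_n) (x : 'cV[R]_n) :
  (0 < k)%N -> A = \sum_(r < n) lam r *: outer (fun _ : 'I_k => v r) ->
  tensor_apply A x = \sum_(r < n) (lam r * dotv x (v r) ^+ k.-1) *: v r.
Proof.
case: k A => // m A _ A_eq; apply/colP => j; rewrite mxE summxE.
(* Here [m] is k - 1. Position [m] lies past the end of [J], so the last mode gets the default [j]
   and splits off the factor [v r j 0]. *)
have entryE (J : m.-tuple 'I_n) : A (@idx_rcons m.+1 n J j) =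
    \sum_(r < n) lam r * v r j 0 * \prod_(i < m) v r (tnth J i) 0 :> R.
  rewrite A_eq sum_ffunE; apply: eq_bigr => r _.
  rewrite !ffunE big_ord_recr /= [_ * v r _ _]mulrC /GRing.scale /= mulrA.
  rewrite tnth_mktuple /= nth_default ?size_tuple //; congr (_ * _).
  by apply: eq_bigr => i _; rewrite tnth_mktuple /= (tnth_nth j).
under eq_bigr do rewrite entryE mulr_suml.
rewrite exchange_big /=; apply: eq_bigr => r _; rewrite mxE.
under eq_bigr do rewrite /= -[_ * _ * _ * _]mulrA -big_split /=.
rewrite -mulr_sumr mulrAC; congr (_ * _ * _).
(* The power, read as a constant product of sums, distributes into a sum over functions from ['I_m]
   to ['I_n], which are then matched with tuples. *)
rewrite -[m in RHS]card_ord -prodr_const bigA_distr_bigA /=.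
rewrite (reindex (@tuple_of_finfun 'I_n m)) /=; last first.
  exists (@finfun_of_tuple 'I_n m) => J _.
    exact: tuple_of_finfunK.
  exact: finfun_of_tupleK.
by apply: eq_bigr => f _; apply: eq_bigr => i _; rewrite tnth_mktuple mulrC.
Qed.

Section ScalarDynamics.
Variables (R : realType) (m : nat) (l mu c : R) (a : nat -> R).
Hypotheses (m_gt0 : (0 < m)%N) (mu_ge0 : 0 <= mu) (muE : mu ^+ m = `|l|).
Hypotheses (a0 : a 0%N = c) (aS : forall t, a t.+1 = l * a t ^+ m.+1).

(** Here [m] plays k - 2: since [mu ^+ m] absorbs the modulus of [l], scaling by [mu] turns the
    recurrence into a pure power map. *)
Lemma scaled_iterE t : `|a t| * mu = (`|c| * mu) ^+ (m.+1 ^ t).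
Proof.
elim: t => [|t IHt]; first by rewrite a0 expr1.
rewrite aS expnS mulnC exprM -IHt exprMn normrM normrX -muE.
by rewrite mulrAC -exprSr mulrC.
Qed.

(* The estimate is on [`|a t|] rather than on [`|a t| * mu] so that it also
   covers [mu = 0]. *)
Lemma iter_le t : `|c| * mu <= 1 -> `|a t| <= (`|c| * mu) ^+ t * `|c|.
Proof.
set b := `|c| * mu => b_le1; have b_ge0 : 0 <= b by rewrite mulr_ge0.
elim: t => [|t IHt]; first by rewrite a0 mul1r.
(* The growth factor of one step is b^(m (m+1)^t), at most b because the exponent is positive and b
   <= 1. *)
have -> : `|a t.+1| = (`|a t| * mu) ^+ m * `|a t|.
  by rewrite aS normrM normrX -muE exprMn exprS mulrA mulrAC [_ * mu ^+ m]mulrC.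
rewrite exprS -mulrA scaled_iterE -exprM; apply: ler_pM => //.
  exact: exprn_ge0.
by rewrite -[leRHS]expr1 ler_wiXn2l // ?muln_gt0 ?expn_gt0.
Qed.

(** As m + 1 >= 2, the exponent (m+1)^t exceeds t. *)
Lemma le_scaled_iter t : 1 <= `|c| * mu -> (`|c| * mu) ^+ t <= `|a t| * mu.
Proof.
by move=> b_ge1; rewrite scaled_iterE ler_weXn2l // ltnW // ltn_expl.
Qed.

End ScalarDynamics.

(** For positive [M], the powers of 1/b tend to 0 and so drop below 1/M. *)
Lemma exprn_unbounded (R : realType) (b M : R) : 1 < b ->
  exists t : nat, M < b ^+ t.
Proof.
move=> b_gt1; have b_gt0 : 0 < b by exact: lt_trans b_gt1.
have [M_le0|M_gt0] := leP M 0.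
  by exists 0%N; rewrite (le_lt_trans M_le0) ?expr0.
have b1_lt1 : `|b^-1| < 1 by rewrite gtr0_norm ?invr_gt0 // invf_lt1.
have M1_gt0 : 0 < M^-1 by rewrite invr_gt0.
have [N _ /(_ N (leqnn N))] := cvgr_lt 0 (cvg_expr b1_lt1) _ M1_gt0.
by rewrite /= exprVn ltf_pV2 ?posrE ?exprn_gt0 //; exists N.
Qed.

Theorem proposition2 (R : realType) (k n : nat)
    (k_ge3 : (3 <= k)%N) (n_ge1 : (1 <= n)%N)
    (A : tensor R k n) (A_sym : supersymmetric A)
    (lam : 'I_n -> R) (v : 'I_n -> 'cV[R]_n)
    (A_odec : orthogonal_decomposition A lam v)
    (c : 'I_n -> R) (x : nat -> 'cV[R]_n)
    (x_init : x 0%N = \sum_(r < n) c r *: v r)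
    (x_step : forall t : nat, x t.+1 = tensor_apply A (x t)) :
  [/\ stable_origin x <->
        (forall r : 'I_n, `|c r| * `|lam r| `^ ((k - 2)%N%:R^-1) <= 1),
      asymptotically_stable_origin x <->
        (forall r : 'I_n, `|c r| * `|lam r| `^ ((k - 2)%N%:R^-1) < 1)
    & unstable_origin x <->
        (exists r : 'I_n, 1 < `|c r| * `|lam r| `^ ((k - 2)%N%:R^-1))].
Proof.
case: A_odec => _ v_on A_eq.
pose mu r := `|lam r| `^ ((k - 2)%N%:R^-1).
pose a r t := dotv (x t) (v r).
have a0 r : a r 0%N = c r by rewrite /a x_init dotv_orthonormal.
have [m_gt0 kE] : (0 < k - 2)%N /\ (k - 2).+1 = k.-1.
  by case: k k_ge3 {A A_sym A_eq x_step mu} => [|[|[|k]]].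
have x_next t : x t.+1 = \sum_(r < n) (lam r * a r t ^+ (k - 2).+1) *: v r.
  by rewrite x_step kE; apply: tensor_apply_outer => //; exact: leq_trans k_ge3.
have aS r t : a r t.+1 = lam r * a r t ^+ (k - 2).+1.
  by rewrite /a x_next dotv_orthonormal.
have xE t : x t = \sum_(r < n) a r t *: v r.
  (* The initial state is given in the span of the frame, and every later state lies there by
     [x_next]. *)
  case: t => [|t]; first by rewrite x_init; under [RHS]eq_bigr do rewrite a0.
  by rewrite x_next; under [RHS]eq_bigr do rewrite aS.
have a_le r t : `|a r t| <= enorm (x t).
  rewrite xE enorm_orthonormal // -sqrtr_sqr ler_wsqrtr //.
  by rewrite (bigD1 r) //= lerDl sumr_ge0 // => s _; rewrite sqr_ge0.
have mu_ge0 r : 0 <= mu r by exact: powR_ge0.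
have muE r : mu r ^+ (k - 2) = `|lam r|.
  rewrite -powR_mulrn // /mu -powRrM mulVf ?powRr1 // pnatr_eq0.
  by rewrite -lt0n.
have stableP : stable_origin x <-> forall r, `|c r| * mu r <= 1.
  split=> [[gamma gamma_gt0 x_le] r|b_le1].
    rewrite leNgt; apply/negP => b_gt1.
    (* The threshold is the bound that stability imposes on the rescaled coordinate at every
       time. *)
    have [t] := exprn_unbounded (gamma * enorm (x 0%N) * mu r) b_gt1.
    apply/negP; rewrite -leNgt.
    apply: le_trans
      (le_scaled_iter m_gt0 (muE r) (a0 r) (aS r) t (ltW b_gt1)) _.
    by rewrite ler_wpM2r // (le_trans (a_le r t)).
  (* The constant 1 suffices: no coordinate ever exceeds its initial modulus. *)
  exists 1 => // t; rewrite mul1r !xE !enorm_orthonormal // ler_wsqrtr //.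
  apply: ler_sum => r _; rewrite -[leLHS]real_normK ?num_real //.
  rewrite -[leRHS]real_normK ?num_real // lerXn2r ?nnegrE // a0.
  apply: le_trans
    (iter_le m_gt0 (mu_ge0 r) (muE r) (a0 r) (aS r) t (b_le1 r)) _.
  by rewrite ler_piMl // exprn_ile1 // mulr_ge0.
split; first exact: stableP.
  split=> [x_cvg r|b_lt1].
    rewrite ltNge; apply/negP => b_ge1.
    (* Convergence of the state would bring the rescaled coordinate below 1, whereas b >= 1 keeps it
       at least 1. *)
    have a_cvg : (fun t => `|a r t| * mu r) @ \oo --> (0 : R).
      rewrite -[X in _ --> X](mul0r (mu r)); apply: cvgMl.
      apply/norm_cvg0P.
      have -> : (0 : R) = \sum_(i < n) 0 * v r i 0.
        by rewrite big1 // => i _; rewrite mul0r.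
      apply: cvg_big; first exact: add_continuous.
      move=> i _; apply: cvgMl.
      have -> : (0 : R) = (0 : 'cV[R]_n) i 0 by rewrite mxE.
      exact: cvg_comp x_cvg (@coord_continuous _ _ _ i 0 _).
    have [N _ /(_ N (leqnn N))] := cvgr_lt 0 a_cvg _ ltr01.
    apply/negP; rewrite -leNgt.
    apply: le_trans (le_scaled_iter m_gt0 (muE r) (a0 r) (aS r) N b_ge1).
    exact: exprn_ege1.
  have a_cvg r : a r t @[t --> \oo] --> (0 : R).
    apply/norm_cvg0P.
    (* The geometric bound of [iter_le] gives decay even when [mu r] is 0. *)
    apply: (@squeeze_cvgr _ _ _ _ (fun=> 0)
      (fun t => (`|c r| * mu r) ^+ t * `|c r|)).
    - apply: nearW => t; rewrite normr_ge0 /=.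
      exact: (iter_le m_gt0 (mu_ge0 r) (muE r) (a0 r) (aS r) t (ltW (b_lt1 r))).
    - exact: cvg_cst.
    - rewrite -[X in _ --> X](mul0r `|c r|); apply: cvgMl.
      by apply: cvg_expr; rewrite ger0_norm // mulr_ge0.
  rewrite /asymptotically_stable_origin.
  have -> : 0 = \sum_(r < n) (0 : R) *: v r.
    by rewrite big1 // => r _; rewrite scale0r.
  have -> : x = (fun t => \sum_(r < n) a r t *: v r) by apply/funext => t.
  apply: cvg_big; first exact: add_continuous.
  by move=> r _; apply: cvgZr_tmp.
rewrite /unstable_origin stableP; split=> [/existsNP[r /negP]|[r b_gt1] b_le1].
  by rewrite -ltNge; exists r.
by have := b_le1 r; rewrite leNgt b_gt1.
Qed.
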